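(* Let $F$ be an arbitrary field of characteristic $4k+1$ for some integer $k$ (i.e. the characteristic is a prime congruent to $1$ modulo $4$). Then the $2$-valued group $\mathcal{X}_F=(F/\iota)\times(F^\times/\iota)$ is not coset, i.e. it is not isomorphic to a coset group $G/\psi(H)$ for any group $G$, any group $H$ of order $2$, and any homomorphism $\psi:H\to\operatorname{Aut}(G)$.
   Context: Let $\iota$ denote the involution $f\mapsto -f$; $[a]$ with a single entry denotes an equivalence class (for $\iota$ it is $\{a,-a\}$), and $[x_1,\dots,x_k]$ with $k\geq 2$, or $[x_h]_{h\in H}$, denotes a multiset. For a field $F$, $\mathcal{X}_F$ is the $2$-valued group $(F/\iota)\times(F^\times/\iota)$ with the operation $$([a],[b])*([c],[d])=\bigl[([a+bc],[bd]),([a-bc],[bd])\bigr].$$ For a group $G$ and a homomorphism $\psi:H\to\operatorname{Aut}(G)$ from a group $H$ of order $n$, the coset group $G/\psi(H)$ is the set of orbits of $G$ under $H$ with the $n$-valued operation $[g_1]*[g_2]=[\,[g_1\psi(h)(g_2)]\,]_{h\in H}$, where $[g]$ is the orbit of $g$. An isomorphism of $2$-valued groups is a bijection $f$ such that $f(x)*f(y)$ is the image multiset $f(x*y)$ for all $x,y$. *)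

(* Defs.v *)
From HB Require Import structures.
From mathcomp Require Import all_boot all_fingroup all_algebra.
From mathcomp Require Import finmap multiset.
From mathcomp Require Import generic_quotient. (* repr is that of quotients *)

Set Implicit Arguments.
Unset Strict Implicit.
Unset Printing Implicit Defensive.

Import GRing.Theory.
Local Open Scope quotient_scope.
Local Open Scope mset_scope.

Definition mset_map (T U : choiceType) (f : T -> U) (m : {mset T}) : {mset U} :=
  seq_mset [seq f x | x <- m].

Lemma mset_map_seq (T U : choiceType) (f : T -> U) (s : seq T) :
  mset_map f (seq_mset s) = seq_mset (map f s).
Proof. exact/eq_seq_msetP/perm_map/perm_eq_seq_mset. Qed.

Definition mvop (T : choiceType) := T -> T -> {mset T}.

Definition mv_iso (T U : choiceType) (opT : mvop T) (opU : mvop U)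
    (f : T -> U) : Prop :=
  bijective f /\ forall x y, opU (f x) (f y) = mset_map f (opT x y).

Section CosetGroup.
Local Open Scope group_scope.

(* A homomorphism H -> Aut(G), the product of Aut(G) being composition
   (psi (h * k) applies psi k first). *)
Record aut_hom (H : finGroupType) (G : groupType) := AutHom {
  aut_hom_fun :> H -> {multiplicative G -> G};
  aut_hom_bij : forall h, bijective (aut_hom_fun h);
  aut_homM : forall h k x,
    aut_hom_fun (h * k) x = aut_hom_fun h (aut_hom_fun k x)
}.

Variables (H : finGroupType) (G : groupType) (psi : aut_hom H G).

Lemma aut_hom1 x : psi 1 x = x.
Proof.
by apply: (bij_inj (aut_hom_bij psi 1)); rewrite -aut_homM mulg1.
Qed.

Definition same_orbit (x y : G) : bool := [exists h : H, y == psi h x].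

Lemma same_orbit_refl : reflexive same_orbit.
Proof. by move=> x; apply/existsP; exists 1; rewrite aut_hom1. Qed.

Lemma same_orbit_sym : symmetric same_orbit.
Proof.
suff sub x y : same_orbit x y -> same_orbit y x.
  by move=> x y; apply/idP/idP; apply: sub.
case/existsP=> h /eqP->; apply/existsP; exists h^-1.
by rewrite -aut_homM mulVg aut_hom1.
Qed.

Lemma same_orbit_trans : transitive same_orbit.
Proof.
move=> y x z /existsP[h /eqP->] /existsP[k /eqP->].
by apply/existsP; exists (k * h); rewrite aut_homM.
Qed.

Canonical same_orbit_equiv :=
  EquivRel same_orbit same_orbit_refl same_orbit_sym same_orbit_trans.

Definition orbits := {eq_quot same_orbit}.

HB.instance Definition _ := Choice.on orbits.
HB.instance Definition _ := EqQuotient.on orbits.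

(* Independent of the representatives: see coset_op_pi. *)
Definition coset_op : mvop orbits := fun x y =>
  seq_mset [seq \pi_orbits (repr x * psi h (repr y)) | h <- enum H].

Lemma orbit_pi (x : G) (h : H) : \pi_orbits (psi h x) = \pi_orbits x.
Proof.
by apply/eqmodP; rewrite /= same_orbit_sym; apply/existsP; exists h.
Qed.

Lemma coset_op_pi (x y : G) :
  coset_op (\pi x) (\pi y) =
  seq_mset [seq \pi_orbits (x * psi h y) | h <- enum H].
Proof.
have rep z : exists h, repr (\pi_orbits z) = psi h z.
  have /eqmodP/existsP[h /eqP e] :
    z = repr (\pi_orbits z) %[mod orbits] by rewrite reprK.
  by exists h.
rewrite /coset_op; have [a ->] := rep x; have [b ->] := rep y.
transitivity (seq_mset
    [seq \pi_orbits (x * psi h y) | h <- [seq a^-1 * h * b | h <- enum H]]).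
  congr seq_mset; rewrite -[in RHS]map_comp; apply: eq_map => h /=.
  rewrite -(orbit_pi (x * _) a) gmulfM.
  by rewrite -!aut_homM !mulgA mulgV mul1g.
apply/eq_seq_msetP/perm_map; apply: uniq_perm; rewrite ?enum_uniq //.
  by rewrite map_inj_uniq ?enum_uniq // => h k /mulIg/mulgI.
move=> h; rewrite mem_enum inE; apply/mapP; exists (a * h * b^-1).
  by rewrite mem_enum.
by rewrite !mulgA mulVg mul1g -mulgA mulVg mulg1.
Qed.

End CosetGroup.

Arguments coset_op {H G} psi.

Definition is_coset (n : nat) (T : choiceType) (op : mvop T) : Prop :=
  exists (G : groupType) (H : finGroupType) (psi : aut_hom H G),
    #|H| = n /\ exists f : T -> orbits psi, mv_iso op (coset_op psi) f.

Section XF.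
Local Open Scope ring_scope.

Variable F : fieldType.

Definition eq_opp (x y : F) : bool := (x == y) || (x == - y).

Lemma eq_opp_refl : reflexive eq_opp.
Proof. by move=> x; rewrite /eq_opp eqxx. Qed.

Lemma eq_opp_sym : symmetric eq_opp.
Proof. by move=> x y; rewrite /eq_opp -eqr_oppLR ![_ == y]eq_sym. Qed.

Lemma eq_opp_trans : transitive eq_opp.
Proof.
move=> y x z /orP[]/eqP-> // /orP[]/eqP->;
  by rewrite /eq_opp ?opprK eqxx ?orbT.
Qed.

Canonical eq_opp_equiv := EquivRel eq_opp eq_opp_refl eq_opp_sym eq_opp_trans.

Definition F_iota := {eq_quot eq_opp}.
HB.instance Definition _ := Choice.on F_iota.
HB.instance Definition _ := EqQuotient.on F_iota.

(* The library's {unit F} requires F to be finite. *)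
Definition Fx := {x : F | x \is a GRing.unit}.
HB.instance Definition _ := Choice.on Fx.
HB.instance Definition _ := SubType.on Fx.

Lemma Fx_mul_subproof (u v : Fx) : val u * val v \is a GRing.unit.
Proof. by rewrite unitrM (valP u) (valP v). Qed.

Definition Fx_mul (u v : Fx) : Fx := Sub (val u * val v) (Fx_mul_subproof u v).

Lemma val_Fx_mul u v : val (Fx_mul u v) = val u * val v.
Proof. by []. Qed.

Definition Fx_eq_opp (u v : Fx) : bool := eq_opp (val u) (val v).

Lemma Fx_eq_opp_refl : reflexive Fx_eq_opp.
Proof. by move=> u; apply: eq_opp_refl. Qed.

Lemma Fx_eq_opp_sym : symmetric Fx_eq_opp.
Proof. by move=> u v; apply: eq_opp_sym. Qed.

Lemma Fx_eq_opp_trans : transitive Fx_eq_opp.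
Proof. by move=> v u w; apply: eq_opp_trans. Qed.

Canonical Fx_eq_opp_equiv :=
  EquivRel Fx_eq_opp Fx_eq_opp_refl Fx_eq_opp_sym Fx_eq_opp_trans.

Definition Fx_iota := {eq_quot Fx_eq_opp}.
HB.instance Definition _ := Choice.on Fx_iota.
HB.instance Definition _ := EqQuotient.on Fx_iota.

Definition X_type : choiceType := (F_iota * Fx_iota)%type.

(* Independent of the representatives: see X_op_pi. *)
Definition X_op : mvop X_type := fun x y =>
  let a := repr x.1 in let b := repr x.2 in
  let c := repr y.1 in let d := repr y.2 in
  seq_mset
    [:: (\pi_F_iota (a + val b * c), \pi_Fx_iota (Fx_mul b d));
        (\pi_F_iota (a - val b * c), \pi_Fx_iota (Fx_mul b d))].

Lemma X_op_pi (a c : F) (b d : Fx) :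
  X_op (\pi a, \pi b) (\pi c, \pi d) =
  seq_mset
    [:: (\pi_F_iota (a + val b * c), \pi_Fx_iota (Fx_mul b d));
        (\pi_F_iota (a - val b * c), \pi_Fx_iota (Fx_mul b d))].
Proof.
have repF x : {s : bool | repr (\pi_F_iota x) = (-1) ^+ s * x}.
  have /eqmodP : repr (\pi_F_iota x) = x %[mod F_iota] by rewrite reprK.
  case/boolP: (repr (\pi_F_iota x) == x) => [/eqP-> _|n /orP].
    by exists false; rewrite mul1r.
  rewrite (negPf n) => e; exists true; rewrite mulN1r.
  by case: e => // /eqP.
have repFx u : {s : bool | val (repr (\pi_Fx_iota u)) = (-1) ^+ s * val u}.
  have /eqmodP : repr (\pi_Fx_iota u) = u %[mod Fx_iota] by rewrite reprK.
  set v := repr _; case/boolP: (val v == val u) => [/eqP-> _|n /orP].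
    by exists false; rewrite mul1r.
  rewrite (negPf n) => e; exists true; rewrite mulN1r.
  by case: e => // /eqP.
have piF x y : eq_opp x y -> \pi_F_iota x = \pi_F_iota y by move/eqmodP.
have piFx u v : Fx_eq_opp u v -> \pi_Fx_iota u = \pi_Fx_iota v.
  by move/eqmodP.
rewrite /X_op /=.
have [sa ->] := repF a; have [sc ->] := repF c.
have -> : \pi_Fx_iota (Fx_mul (repr (\pi_Fx_iota b)) (repr (\pi_Fx_iota d))) =
    \pi_Fx_iota (Fx_mul b d).
  apply: piFx; rewrite /Fx_eq_opp !val_Fx_mul.
  have [sb ->] := repFx b; have [sd ->] := repFx d.
  by case: sb; case: sd; rewrite /eq_opp !(mulN1r, mul1r, mulNr, mulrN, opprK)
    eqxx ?orbT.
have [sb ->] := repFx b.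
have [e|e] : (-1) ^+ sb * ((-1) ^+ sc) = (-1) ^+ sa :> F \/
             (-1) ^+ sb * ((-1) ^+ sc) = - (-1) ^+ sa :> F.
  by case: sa sb sc => [] [] []; rewrite ?(mulN1r, mul1r, opprK); auto.
- rewrite mulrACA e -mulrDr -mulrBr; congr (seq_mset [:: (_, _); (_, _)]);
  by apply: piF; case: sa {e}; rewrite /eq_opp ?(mulN1r, mul1r) eqxx ?orbT.
rewrite mulrACA e !mulNr opprK -mulrDr -mulrBr.
apply/eq_seq_msetP; rewrite -[X in perm_eq X _]/([:: _] ++ [:: _]) perm_catC /=.
rewrite (piF (_ * (a + _)) (a + val b * c)) ?(piF (_ * (a - _)) (a - val b * c)) //;
  by case: sa {e}; rewrite /eq_opp ?(mulN1r, mul1r) eqxx ?orbT.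
Qed.

End XF.

Arguments X_op F : clear implicits.

(* Main.v *)
Require Import Defs.
From HB Require Import structures.
From mathcomp Require Import all_boot all_fingroup all_algebra.
From mathcomp Require Import multiset generic_quotient.

Set Implicit Arguments.
Unset Strict Implicit.
Unset Printing Implicit Defensive.

Import GRing.Theory.
Local Open Scope quotient_scope.

(** Suppose that the [2]-valued group [X_F] is the orbit space of a group [G]
    under an involution [s], and write [q : G -> X_F] for the quotient map, so
    that the product of [q g] and [q h] is the multiset of [q (g * h)] and
    [q (g * s h)], while the fibers of [q] are the sets [{g, s g}].

    The fiber over the identity [([0], [1])] is [{1}], and this turns the
    product rule of [X_F] into equations in [G].  Over [([1], [1])] there is an
    element [n] which [s] inverts ([inverted_over]), hence [n ^+ m] lies over
    [([m], [1])] for every [m] ([orbit_mapX]): powers of [n] form a copy of the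
    prime field.  An element [t] over [([0], [b])] is fixed by [s]
    ([orbit_map_fixed]), and it conjugates [n] to one of the two elements over
    [([b^-1], [1])]; in other words, the second factor of [X_F] acts on the
    first one by honest automorphisms lifting the multiplications.

    If the characteristic is [1] modulo [4], then [-1] is the square of an
    integer [j] in [F] (Wilson's theorem).  Take [b = j].  As [[j ^ 2] = [1]],
    the element [t] has square [1], so conjugating twice by [t] fixes [n].  On
    the other hand [t] conjugates [n] to [n ^+ j] or its inverse, because [j]
    and its inverse are equal up to sign, so conjugating twice gives
    [n ^+ (j * j) = n^-1].  Hence [n * n = 1], although [n * n] lies over
    [([2], [1])]: a contradiction, since [2 != 0] in [F]
    ([orbit_map_no_sqrtN1]). *)

(** * Coset groups of order two as quotients by an involution *)

Lemma seq_mset2_inj (T : choiceType) (x y u v : T) :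
  seq_mset [:: x; y] = seq_mset [:: u; v] ->
  (x = u /\ y = v) \/ (x = v /\ y = u).
Proof.
move/eq_seq_msetP=> e; have := perm_mem e x; rewrite !inE eqxx /=.
case/esym/orP=> /eqP ex; move: e; rewrite ex.
  by rewrite perm_cons => /perm_small_eq-/(_ isT)[]; left.
rewrite -[X in perm_eq _ X]/([:: u] ++ [:: v]) perm_sym perm_catC perm_cons.
by move/perm_small_eq=> /(_ isT)[]; right.
Qed.

Section OrbitMap.
Local Open Scope group_scope.

Lemma aut_hom_gmulf1 (H : finGroupType) (G : groupType) (psi : aut_hom H G)
    (h : H) : psi h 1 = 1.
Proof. by apply: (mulgI (psi h 1)); rewrite -gmulfM !mulg1. Qed.

(** Identifies the [2]-valued group [(T, op)] with the coset group of [G] under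
    the automorphism [s]: [q] is the quotient map read through an isomorphism
    with [T].  [s] may be the identity, as the homomorphism from the group of
    order two may be trivial. *)
Record orbit_map (T : choiceType) (op : mvop T) (G : groupType)
    (s : UMagmaMorphism.type G G) (q : G -> T) : Prop := OrbitMap {
  orbit_map_surj : forall x, exists g, q g = x;
  orbit_map_fiber : forall g h, q g = q h -> h = g \/ h = s g;
  orbit_map_invol : involutive s;
  orbit_mapM : forall g h, op (q g) (q h) = seq_mset [:: q (g * h); q (g * s h)]
}.

Lemma is_coset2_orbit_map (T : choiceType) (op : mvop T) :
  is_coset 2 op ->
  exists (G : groupType) (s : UMagmaMorphism.type G G) (q : G -> T),
    orbit_map op s q.
Proof.
case=> G [H [psi [H2 [f [[f' fK f'K] fM]]]]].
have /eqP/cards2P[a [b [ab eH]]] : #|[set: H]| = 2 by rewrite cardsT.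
have [h [h1 enH]] : exists h : H, h != 1 /\ [set: H] = [set 1; h].
  have : 1 \in [set a; b] by rewrite -eH inE.
  rewrite !inE => /orP[]/eqP e; [exists b | exists a].
    by rewrite e eq_sym.
  by rewrite e setUC.
have Hcase k : k = 1 \/ k = h.
  have : k \in [set 1; h] by rewrite -enH inE.
  by rewrite !inE => /orP[]/eqP; [left | right].
have hh : h * h = 1.
  by case: (Hcase (h * h)) => // /(canRL (mulKg h)); rewrite mulVg => e;
     rewrite e eqxx in h1.
have pH : perm_eq (enum H) [:: 1; h].
  apply: uniq_perm; rewrite ?enum_uniq //= ?inE ?andbT 1?eq_sym //.
  by move=> k; rewrite mem_enum !inE; case: (Hcase k) => ->; rewrite eqxx ?orbT.
(* The structure with the unit law gives access to the morphism theory. *)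
pose psi1 := Multiplicative_isUMagmaMorphism.Build G G (psi h)
  (aut_hom_gmulf1 psi h).
pose s : UMagmaMorphism.type G G := HB.pack (Multiplicative.sort (psi h)) psi1.
exists G, s, (fun g => f' (\pi_(orbits psi) g)); split.
- by move=> x; exists (repr (f x)); rewrite reprK fK.
- move=> x y /(can_inj f'K)/eqmodP/existsP[k /eqP->].
  by case: (Hcase k) => ->; rewrite ?aut_hom1; [left | right].
- by move=> x; rewrite -aut_homM hh aut_hom1.
move=> x y; set m := op _ _.
have fm : mset_map f m =
    mset_map f (seq_mset [:: f' (\pi_(orbits psi) (x * y));
                            f' (\pi_(orbits psi) (x * psi h y))]).
  rewrite -fM !f'K coset_op_pi mset_map_seq /= !f'K.
  apply/eq_seq_msetP; apply: perm_trans (perm_map _ pH) _.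
  by rewrite /= aut_hom1.
(* The multisets agree after [f], which is injective on multisets. *)
have mapK (r : {mset T}%mset) : mset_map f' (mset_map f r) = r.
  by rewrite {2}/mset_map mset_map_seq -map_comp (eq_map fK) map_id seq_mset_id.
by rewrite -[m]mapK fm mapK.
Qed.

End OrbitMap.

(** * A square root of -1 in characteristic 4k + 1 *)

Section SquareRoot.
Local Open Scope ring_scope.

(** Modulo [p] the factors [p - 1, p - 2, ...] are [-1, -2, ...]. *)
Lemma natr_ffact_pchar (R : nzRingType) (p m : nat) :
  p \in [pchar R] -> (m < p)%N ->
  (p.-1 ^_ m)%:R = (-1) ^+ m * (m`!)%:R :> R.
Proof.
move=> charR; elim: m => [|m IH] lt_mp; first by rewrite mul1r.
rewrite ffactnSr natrM (IH (ltnW lt_mp)) factS natrM.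
have -> : (p.-1 - m)%:R = - m.+1%:R :> R.
  apply/eqP; rewrite -addr_eq0 -natrD -subn1 -subnDA add1n.
  by rewrite subnK ?(ltnW lt_mp) // (pcharf0 charR).
by rewrite mulrN exprS mulN1r mulNr -mulrA -!natrM mulnC.
Qed.

(** Wilson's theorem gives [(p - 1)! = -1]; the upper half of this product
    equals the lower half [(2 * k)!], as its [2 * k] signs cancel. *)
Lemma sqr_fact_half_pred (F : fieldType) (p k : nat) :
  p \in [pchar F] -> p = (4 * k + 1)%N -> (((2 * k)`!)%:R ^+ 2 = -1 :> F).
Proof.
move=> charF hp; have p_pr := pcharf_prime charF.
have : (p.-1`!.+1)%:R = 0 :> F.
  by apply/eqP; rewrite -(dvdn_pcharf charF) -Wilson ?prime_gt1.
have p1 : p.-1 = (2 * k + 2 * k)%N by rewrite hp addn1 /= -mulnDl.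
rewrite -(@ffact_fact p.-1 (2 * k)) ?p1 ?leq_addr // addnK -p1.
rewrite -addn1 natrD natrM (natr_ffact_pchar charF); last first.
  by rewrite -(prednK (prime_gt0 p_pr)) p1 ltnS leq_addr.
by rewrite exprM sqrrN expr1n expr1n mul1r => /eqP; rewrite addr_eq0 => /eqP.
Qed.

End SquareRoot.


(** * Lifting the product of X_F along an orbit map *)

Section XF.
Variable F : fieldType.
Local Open Scope ring_scope.

Definition Fx1 : Fx F := Sub 1 (unitr1 F).

Definition Xpt (a : F) (b : Fx F) : X_type F :=
  (\pi_(F_iota F) a, \pi_(Fx_iota F) b).

Lemma X_opE a b c d :
  X_op F (Xpt a b) (Xpt c d) =
  seq_mset [:: Xpt (a + val b * c) (Fx_mul b d);
               Xpt (a - val b * c) (Fx_mul b d)].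
Proof. exact: X_op_pi. Qed.

Lemma Fx_mul1 b : Fx_mul Fx1 b = b.
Proof. by apply: val_inj; rewrite val_Fx_mul mul1r. Qed.

Lemma Fx_mulb1 b : Fx_mul b Fx1 = b.
Proof. by apply: val_inj; rewrite val_Fx_mul mulr1. Qed.

Lemma XptNl a b : Xpt (- a) b = Xpt a b.
Proof. by congr (_, _); apply/eqmodP; rewrite /= /eq_opp eqxx orbT. Qed.

Lemma XptNr a (b c : Fx F) : val b = - val c -> Xpt a b = Xpt a c.
Proof.
move=> e; congr (_, _); apply/eqmodP.
by rewrite /= /Fx_eq_opp /eq_opp e eqxx orbT.
Qed.

Lemma Xpt_inj a b c d : Xpt a b = Xpt c d -> a = c \/ a = - c.
Proof. by case=> /eqmodP /orP[]/eqP; [left | right]. Qed.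

Lemma Xpt_neq0 a b c : a != 0 -> Xpt a b <> Xpt 0 c.
Proof. by move=> /eqP a0 /Xpt_inj; rewrite oppr0 => -[]. Qed.

Variables (G : groupType) (s : UMagmaMorphism.type G G) (q : G -> X_type F).
Hypothesis q_orbit : orbit_map (X_op F) s q.

Lemma orbit_map_op g h a b c d : q g = Xpt a b -> q h = Xpt c d ->
  let x := Xpt (a + val b * c) (Fx_mul b d) in
  let y := Xpt (a - val b * c) (Fx_mul b d) in
  (q (g * h)%g = x /\ q (g * s h)%g = y) \/
  (q (g * h)%g = y /\ q (g * s h)%g = x).
Proof.
move=> qg qh; apply: seq_mset2_inj.
by rewrite -(orbit_mapM q_orbit) qg qh X_opE.
Qed.

Lemma orbit_map_op0 g h a b d : q g = Xpt a b -> q h = Xpt 0 d ->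
  q (g * h)%g = Xpt a (Fx_mul b d).
Proof.
by move=> qg qh; case: (orbit_map_op qg qh); rewrite mulr0 addr0 subr0 => -[].
Qed.

Lemma orbit_map_0op g h b c d : q g = Xpt 0 b -> q h = Xpt c d ->
  q (g * h)%g = Xpt (val b * c) (Fx_mul b d) /\
  q (g * s h)%g = Xpt (val b * c) (Fx_mul b d).
Proof.
by move=> qg qh; case: (orbit_map_op qg qh); rewrite !add0r XptNl.
Qed.

(** If [g] lies over the identity, then so does [g * s g], which is thus [g] or
    [s g]; both force [s g = 1]. *)
Lemma orbit_map_id g : q g = Xpt 0 Fx1 -> g = 1%g.
Proof.
move=> qg; case: (orbit_map_0op qg qg); rewrite mulr0 Fx_mul1 -qg => _ e.
have sg1 : s g = 1%g.
  case: (orbit_map_fiber q_orbit e) => {e}.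
    by rewrite -[X in X = _]mulg1 => /mulgI.
  rewrite gmulfM (orbit_map_invol q_orbit) -[X in X = _]mul1g.
  by move/mulIg.
by rewrite -(orbit_map_invol q_orbit g) sg1 gmulf1.
Qed.

Lemma orbit_map1 : q 1%g = Xpt 0 Fx1.
Proof.
have [g qg] := orbit_map_surj q_orbit (Xpt 0 Fx1).
by rewrite -(orbit_map_id qg).
Qed.

(** Halving [a] makes this work: for [g] over [([a / 2], [1])], one of [g * g]
    and [g * s g] lies over [([a], [1])] and the other one is [1].  If
    [g * s g = 1], then [s] inverts [g], hence [g * g]; if [g * g = 1], then
    [s g] is an involution too, and [s] inverts the product of the involutions
    [g] and [s g] by exchanging them. *)
Lemma inverted_over a : 2%:R != 0 :> F ->
  exists n, q n = Xpt a Fx1 /\ s n = n^-1%g.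
Proof.
move=> F2; have [g qg] := orbit_map_surj q_orbit (Xpt (a / 2%:R) Fx1).
case: (orbit_map_op qg qg);
  rewrite Fx_mul1 mul1r -mulr2n -[a / _ *+ 2]mulr_natr divfK //.
  rewrite subrr => -[qgg /orbit_map_id gsg]; exists (g * g)%g; split => //.
  by rewrite gmulfM invMg; rewrite (canRL (mulKg g) gsg) mulg1.
rewrite subrr => -[/orbit_map_id gg qgsg]; exists (g * s g)%g; split => //.
have gV : g^-1%g = g by apply: (mulgI g); rewrite mulgV gg.
by rewrite gmulfM (orbit_map_invol q_orbit) invMg -gmulfV gV.
Qed.

(** Multiplying [n ^+ m.+1] by [n] and by [s n = n^-1] gives elements over
    [(m + 2) * a] and [m * a] in some order; the induction hypothesis tells that
    the second one, [n ^+ m], lies over [m * a], which decides the order. *)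
Lemma orbit_mapX n a m : q n = Xpt a Fx1 -> s n = n^-1%g ->
  q (n ^+ m)%g = Xpt (a *+ m) Fx1.
Proof.
move=> qn sn.
suff [] : q (n ^+ m)%g = Xpt (a *+ m) Fx1 /\
          q (n ^+ m.+1)%g = Xpt (a *+ m.+1) Fx1 by [].
elim: m => [|m [IH IH1]]; first by rewrite expg0 orbit_map1.
split=> //; case: (orbit_map_op IH1 qn);
  rewrite sn mul1r Fx_mul1 -expgSr -mulrSr; first by case.
rewrite (expgSr n m) mulgK IH; have -> : a *+ m.+1 - a = a *+ m.
  by rewrite mulrSr addrK.
by case=> ->.
Qed.

(** The product of [q t] and [q n] is a single point counted twice, so [t * n]
    and [t * n^-1] share an orbit.  They differ as [n * n != 1]; so [s]
    exchanges them, and as [s (t * n) = s t * n^-1] this gives [s t = t]. *)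
Lemma orbit_map_fixed t n b : q t = Xpt 0 b -> q n = Xpt 1 Fx1 ->
  s n = n^-1%g -> (n * n)%g <> 1%g -> s t = t.
Proof.
move=> qt qn sn nn.
case: (orbit_map_0op qt qn) => <- /(orbit_map_fiber q_orbit).
rewrite sn => -[/mulgI e|]; first by case: nn; rewrite {1}e mulVg.
by rewrite gmulfM gmulfV sn invgK => /mulIg.
Qed.

(** A square root of [-1] in the prime field prevents the multiplications by
    [F^*] up to sign from lifting to an action: that of [j] has order two up to
    sign, but it would have to lift to an automorphism of order four. *)
Lemma orbit_map_no_sqrtN1 j : 2%:R != 0 :> F -> j%:R ^+ 2 = -1 :> F -> False.
Proof.
move=> F2 jj; have [n [qn sn]] := inverted_over 1 F2.
have nn : (n * n)%g <> 1%g.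
  move=> e; have := orbit_mapX 2 qn sn.
  by rewrite expgS expg1 e orbit_map1 => /esym; apply: Xpt_neq0.
have ju : j%:R \is a @GRing.unit F.
  by rewrite unitfE -sqrf_eq0 jj oppr_eq0 oner_eq0.
pose b : Fx F := Sub j%:R ju.
have [t qt] := orbit_map_surj q_orbit (Xpt 0 b).
have st := orbit_map_fixed qt qn sn nn.
have tt : (t * t)%g = 1%g.
  apply: orbit_map_id; rewrite (orbit_map_op0 qt qt).
  by apply: XptNr; rewrite val_Fx_mul -expr2 jj.
(* Both [n * t] and [t * n ^+ j] lie over [([1], [j])], as [j * j = -1]. *)
have nt : (n ^ t)%g = (n ^+ j)%g \/ (n ^ t)%g = (n ^- j)%g.
  have qN := orbit_mapX j qn sn.
  have [qtN _] := orbit_map_0op qt qN.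
  move: (orbit_map_op0 qn qt); rewrite Fx_mul1 -XptNl.
  have -> : - 1 = val b * (1 *+ j) by rewrite -jj.
  rewrite -[b in Xpt _ b]Fx_mulb1 -qtN => /esym/(orbit_map_fiber q_orbit).
  rewrite gmulfM gmulfXn st sn expVgn conjgE.
  by case=> ->; rewrite mulKg; [left | right].
have njj : (n ^+ (j * j) * n)%g = 1%g.
  rewrite -expgSr; apply: orbit_map_id.
  by rewrite (orbit_mapX _ qn sn) -addn1 natrD natrM -expr2 jj addNr.
have ntt : ((n ^ t) ^ t = n ^+ (j * j))%g.
  by case: nt => e; rewrite e ?conjVg conjXg e ?expVgn ?invgK expgM.
by move: njj; rewrite -ntt -conjgM tt conjg1.
Qed.

End XF.

Local Open Scope ring_scope.

Theorem theorem1p8 (F : fieldType) (p k : nat)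
    (charF : p \in [pchar F]) (hp : p = (4 * k + 1)%N) :
  ~ is_coset 2 (X_op F).
Proof.
move=> /is_coset2_orbit_map[G [s [q q_orbit]]].
have F2 : 2%:R != 0 :> F.
  rewrite -(dvdn_pcharf charF); apply/negP=> /(@dvdn_leq p 2 isT).
  have := pcharf_prime charF; rewrite hp.
  by case: (k) => // m _; rewrite mulnS.
exact: (orbit_map_no_sqrtN1 q_orbit F2 (sqr_fact_half_pred charF hp)).
Qed.
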